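(* Assume that the non-stationary shift with potentials $((\Sigma_n),T,(\varphi_n))$ satisfies property $(\mathrm{H}^\ast)$, that there exists an invariant sequence $(\mu_k)$ of probability measures (i.e. $\mu_k$ is a Borel probability measure on $\Sigma_k$ and $\mathcal{L}_k^\ast(\mu_{k+1})=\mu_k$ for all $k\in\mathbb{N}_0$), and that the integers $n_k$ (see context) can be chosen such that $t_k$ is uniformly bounded away from $1$, i.e. $\sup_kt_k<1$. Then the invariant sequence $(\mu_k)$ is unique and, moreover, for every $k\in\mathbb{N}_0$ and every Lipschitz function $f:\Sigma_k\to\mathbb{R}$ (with respect to $d_r$), $$\left\|\mathcal{L}_k^nf-\int f\,d\mu_k\right\|_\infty\xrightarrow{n\to\infty}0.$$
   Context: **Non-stationary shift.** $\mathbb{N}_0=\mathbb{N}\cup\{0\}$. For each $n\in\mathbb{N}_0$ let $\mathcal{W}^1_n\subset\mathbb{N}$ and $A_n=(\alpha^n_{ij}:i\in\mathcal{W}^1_n,j\in\mathcal{W}^1_{n+1})$ a matrix with entries in $\{0,1\}$ such that $\sum_{j}\alpha^n_{ij}>0$ for all $i\in\mathcal{W}^1_n$, $n\in\mathbb{N}_0$, and $\sum_{j\in\mathcal{W}^1_{n-1}}\alpha^{n-1}_{ji}>0$ for all $i\in\mathcal{W}^1_n$, $n\in\mathbb{N}$. Put $\Sigma_n=\{(x_0,x_1,\dots):\alpha^{n+i}_{x_ix_{i+1}}=1\ \forall i\ge0\}$ and let $T:\Sigma_n\to\Sigma_{n+1}$ be the shift. $\mathcal{W}^k_n$ is the set of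 $n$-admissible words $(x_0,\dots,x_{k-1})$: $x_i\in\mathcal{W}^1_{n+i}$ and $\alpha^{n+i}_{x_ix_{i+1}}=1$ for consecutive letters. $[a]_n=\{x\in\Sigma_n:x_i=a_i,\ 0\le i<k\}$ for $a\in\mathcal{W}^k_n$; $\tau_a:T^k([a]_n)\to[a]_n$, $x\mapsto ax$, is the inverse branch. $d_r(x,y)=r^{\min\{i:x_i\ne y_i\}}$. **Topological conditions.** $((\Sigma_n),T)$ is topologically transitive if for all $a\in\mathcal{W}^1_{k_1}$, $b\in\mathcal{W}^1_{k_2}$ ($k_1,k_2\in\mathbb{N}_0$) there is a sequence $n_l\nearrow\infty$ with $b\in\mathcal{W}^1_{k_1+n_l}$ and $[a]_{k_1}\cap T^{-n_l}([b]_{k_1+n_l})\ne\emptyset$ for all $l$. It is topologically mixing if it is topologically transitive and for all such $a,b$ there is $N_{ab}$ with $[a]_{k_1}\cap T^{-n}([b]_{k_1+n})\ne\emptyset$ for all $n\ge N_{ab}$ with $b\in\mathcal{W}^1_{k_1+n}$. It has big preimages (b.p.) if it is topologically mixing and there are a finite $\mathcal{I}\subset\mathbb{N}$ and an infinite $\mathcal{K}\subset\mathbb{N}$ such that for all $n\in\mathcal{K}$ and $a\in\mathcal{W}^1_n$ there is $b\in\mathcal{I}\cap\mathcal{W}^1_{n-1}$ with $ba\in\mathcal{W}^2_{n-1}$. **Hölder continuity.** For $f:\Sigma_n\to\mathbb{R}$, $V_k(f)=\sup\{|f(x)-f(y)|:x,y\in[a]_n,\ a\in\mathcal{W}^k_n\}$.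 $f$ is locally $(r,m)$-Hölder continuous if there is $\kappa\ge0$ with $V_k(f)\le\kappa r^k$ for all $k\ge m$; the minimal such $\kappa$ is the Hölder constant of index $m$. **Ruelle operators.** For $\varphi_k:\Sigma_k\to\mathbb{R}$, $\mathcal{L}_k(f)(x)=\sum_{Ty=x}e^{\varphi_k(y)}f(y)$ ($x\in\Sigma_{k+1}$), $\mathcal{L}^n_k=\mathcal{L}_{k+n-1}\circ\cdots\circ\mathcal{L}_k$, $S_n\varphi_k=\sum_{i=0}^{n-1}\varphi_{k+i}\circ T^i$, and $\int f\,d\mathcal{L}_k^\ast(\mu)=\int\mathcal{L}_k(f)\,d\mu$. **Property $(\mathrm{H}^\ast)$:** $((\Sigma_n),T)$ has big preimages, $\mathcal{L}_n(1)=1$ for all $n\in\mathbb{N}_0$, and, for some $r\in(0,1)$, $\varphi_n$ is locally $(r,2)$-Hölder continuous for $n\in\mathbb{N}_0\setminus\mathcal{K}$ and locally $(r,1)$-Hölder continuous for $n\in\mathcal{K}$. $\kappa_n$ is the Hölder constant (of index $2$) of $\varphi_n$ and $B_k:=\exp\sum_{i=1}^{k}\kappa_{k-i}r^i$. **Constants.** Fix $\beta\in(0,1)$; $\alpha_k=B_k/\beta$. The integers $n_k\in\mathbb{N}$ are subject to $n_k\ge\lfloor-\log\alpha_k/\log r\rfloor+1$. Choose $\mathbf{o}_k\in\mathcal{W}^1_k$ and let $m_k$ be the least $n\ge1$ with $k+n\in\mathcal{K}$ and $(A_kA_{k+1}\cdots A_{k+n-2})_{\mathbf{o}_kj}\ge1$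 for all $j\in\mathcal{I}\cap\mathcal{W}^1_{k+n-1}$ (finite by mixing; the empty product is the identity). Fix a finite set $\mathcal{U}_k\subset\mathcal{W}^{m_k}_k$ containing, for each $j\in\mathcal{I}\cap\mathcal{W}^1_{k+m_k-1}$, a word starting with $\mathbf{o}_k$ and ending with $j$, and for each $x\in\Sigma_{k+m_k}$ choose $u(x)\in\mathcal{U}_k$, starting with $\mathbf{o}_k$ and ending in an element of $\mathcal{I}$, with $x\in T^{m_k}([u(x)]_k)$. Set $C_k=\inf_{x\in\Sigma_{k+m_k}}e^{S_{m_k}\varphi_k(\tau_{u(x)}x)}$ and $$t_k=\max\Big\{\beta,\ 1-\frac{(1-r^{n_k}\alpha_k)\,C_{k+n_k}}{B_{k+n_k}}\Big\}.$$ *)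

(* Defs.v *)
From HB Require Import structures.
From mathcomp Require Import all_boot all_order all_algebra.
From mathcomp Require Import all_classical all_reals all_analysis.

Set Implicit Arguments.
Unset Strict Implicit.
Unset Printing Implicit Defensive.

Import Order.TTheory GRing.Theory Num.Theory.
Import numFieldNormedType.Exports.

Local Open Scope classical_set_scope.
Local Open Scope ring_scope.

(* Every Sigma_n is a subset of the one space [seqspace] of all sequences of
   natural numbers, a function on Sigma_n is a function on [seqspace] of which
   only the values on Sigma_n are ever used, and a probability measure on
   Sigma_n is a probability measure on [seqspace] giving mass 1 to Sigma_n.
   The topology is the product of discrete topologies, i.e. the one induced by
   the metrics d_r; Sigma_n is closed in it, so the Borel subsets of Sigma_n are
   the Borel subsets of [seqspace] contained in Sigma_n. *)
Notation seqspace :=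
  (g_sigma_algebraType (@open (prod_topology (fun _ : nat => nat)))).

Definition shiftmap (x : seqspace) : seqspace := fun i => x i.+1.

(* Entries adm n i j with i \notin alph n or j \notin alph n.+1 are junk and
   never used. *)
Record shift_data := ShiftData {
  alph : nat -> set nat ;
  adm : nat -> nat -> nat -> bool }.

Definition nonstationary_shift (R : realType) (S : shift_data) : Prop :=
  (forall n i, alph S n i ->
     (0 < \esum_(j in alph S n.+1) ((adm S n i j)%:R : R)%:E)%E) /\
  (forall n i, alph S n.+1 i ->
     (0 < \esum_(j in alph S n) ((adm S n j i)%:R : R)%:E)%E).

Definition Sigma (S : shift_data) (n : nat) : set seqspace :=
  [set x | forall i, [/\ alph S (n + i) (x i), alph S (n + i).+1 (x i.+1)
                       & adm S (n + i) (x i) (x i.+1)]].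

Definition words (S : shift_data) (n k : nat) : set (seq nat) :=
  [set w | [/\ size w = k,
     (forall i, (i < k)%N -> alph S (n + i) (nth 0%N w i)) &
     (forall i, (i.+1 < k)%N ->
        adm S (n + i) (nth 0%N w i) (nth 0%N w i.+1))]].

Definition cyl (S : shift_data) (n : nat) (a : seq nat) : set seqspace :=
  [set x | Sigma S n x /\ forall i, (i < size a)%N -> x i = nth 0%N a i].

(* the inverse branch tau_a *)
Definition prepend (a : seq nat) (x : seqspace) : seqspace :=
  fun i => if (i < size a)%N then nth 0%N a i else x (i - size a)%N.

Definition seqdist (R : realType) (r : R) (x y : seqspace) : R :=
  if pselect (exists i, x i != y i) is left xy then r ^+ ex_minn xy else 0.

Definition connects (S : shift_data) (k1 n a b : nat) : Prop :=
  cyl S k1 [:: a] `&` iter n shiftmap @^-1` cyl S (k1 + n) [:: b] !=set0.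

Definition topologically_transitive (S : shift_data) : Prop :=
  forall k1 k2 a b, alph S k1 a -> alph S k2 b ->
    exists nl : nat -> nat,
      [/\ nondecreasing_seq nl, nl @ \oo --> \oo &
          forall l, alph S (k1 + nl l) b /\ connects S k1 (nl l) a b].

Definition topologically_mixing (S : shift_data) : Prop :=
  topologically_transitive S /\
  forall k1 k2 a b, alph S k1 a -> alph S k2 b ->
    exists N, forall n, (N <= n)%N -> alph S (k1 + n) b -> connects S k1 n a b.

(* [0 < n] for n in K: the condition at n refers to the alphabet n.-1. *)
Definition big_preimages (S : shift_data) (I K : set nat) : Prop :=
  [/\ topologically_mixing S, finite_set I, infinite_set K,
      (forall n, K n -> (0 < n)%N) &
      forall n a, K n -> alph S n a ->
        exists b, [/\ I b, alph S n.-1 b & words S n.-1 2 [:: b; a]]].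

Definition seq_variation (R : realType) (S : shift_data) (n k : nat)
    (f : seqspace -> R) : \bar R :=
  ereal_sup [set v | exists a x y,
    [/\ words S n k a, cyl S n a x, cyl S n a y & v = `|f x - f y|%:E]].

(* the kappa admissible in the definition of local (r, m)-Hoelder continuity *)
Definition holder_bounds (R : realType) (S : shift_data) (r : R) (n m : nat)
    (f : seqspace -> R) : set R :=
  [set kappa | 0 <= kappa /\
     forall k, (m <= k)%N -> (seq_variation S n k f <= (kappa * r ^+ k)%:E)%E].

Definition locally_holder (R : realType) (S : shift_data) (r : R) (n m : nat)
    (f : seqspace -> R) : Prop :=
  holder_bounds S r n m f !=set0.

(* the infimum is attained whenever f is locally (r, m)-Hoelder *)
Definition holder_constant (R : realType) (S : shift_data) (r : R) (n m : nat)
    (f : seqspace -> R) : R :=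
  inf (holder_bounds S r n m f).

Definition dr_lipschitz (R : realType) (r : R) (D : set seqspace)
    (f : seqspace -> R) : Prop :=
  exists c : R, forall x y, D x -> D y -> `|f x - f y| <= c * seqdist r x y.

(* unordered sum of an absolutely summable family of reals *)
Definition rsum (R : realType) (D : set seqspace) (g : seqspace -> R) : R :=
  fine (\esum_(y in D) (Num.max (g y) 0)%:E) -
  fine (\esum_(y in D) (Num.max (- g y) 0)%:E).

Definition ruelle (R : realType) (S : shift_data) (phi : nat -> seqspace -> R)
    (k : nat) (f : seqspace -> R) : seqspace -> R :=
  fun x => rsum [set y | Sigma S k y /\ shiftmap y = x]
                (fun y => expR (phi k y) * f y).

Fixpoint ruelle_iter (R : realType) (S : shift_data)
    (phi : nat -> seqspace -> R) (k n : nat) (f : seqspace -> R) :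
    seqspace -> R :=
  if n is n'.+1 then ruelle S phi (k + n') (ruelle_iter S phi k n' f) else f.

Definition birkhoff (R : realType) (phi : nat -> seqspace -> R) (n k : nat)
    (x : seqspace) : R :=
  \sum_(i < n) phi (k + i)%N (iter i shiftmap x).

(* L_k^*(mu) = nu, tested on all bounded Borel functions on Sigma_k *)
Definition dual_ruelle_eq (R : realType) (S : shift_data)
    (phi : nat -> seqspace -> R) (k : nat) (mu nu : probability seqspace R) :
    Prop :=
  forall f : seqspace -> R, measurable_fun (Sigma S k) f ->
    (exists M : R, forall x, Sigma S k x -> `|f x| <= M) ->
    \int[nu]_(x in Sigma S k) f x =
    \int[mu]_(x in Sigma S k.+1) ruelle S phi k f x.

Definition invariant_sequence (R : realType) (S : shift_data)
    (phi : nat -> seqspace -> R) (mu : nat -> probability seqspace R) : Prop :=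
  (forall k, mu k (Sigma S k) = 1%E) /\
  (forall k, dual_ruelle_eq S phi k (mu k.+1) (mu k)).

Definition property_Hstar (R : realType) (S : shift_data)
    (phi : nat -> seqspace -> R) (I K : set nat) (r : R) : Prop :=
  [/\ big_preimages S I K,
      (forall n x, Sigma S n.+1 x -> ruelle S phi n (fun=> 1) x = 1),
      0 < r < 1,
      (forall n, ~ K n -> locally_holder S r n 2 (phi n)) &
      (forall n, K n -> locally_holder S r n 1 (phi n))].

Definition Bconst (R : realType) (S : shift_data) (phi : nat -> seqspace -> R)
    (r : R) (k : nat) : R :=
  expR (\sum_(1 <= i < k.+1)
          holder_constant S r (k - i)%N 2 (phi (k - i)%N) * r ^+ i).

Definition alphaconst (R : realType) (S : shift_data)
    (phi : nat -> seqspace -> R) (r beta : R) (k : nat) : R :=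
  Bconst S phi r k / beta.

(* the (i, j) entry of A_k A_{k+1} ... A_{k+p-1}, possibly +oo since the
   alphabets may be infinite *)
Fixpoint adm_prod (R : realType) (S : shift_data) (k p i j : nat) : \bar R :=
  if p is p'.+1 then
    (\esum_(l in alph S (k + p'))
       (adm_prod R S k p' i l * (adm S (k + p') l j)%:R%:E))%E
  else ((i == j)%:R)%:E.

Definition reaches_I (R : realType) (S : shift_data) (I K : set nat)
    (o : nat -> nat) (k n : nat) : Prop :=
  [/\ (1 <= n)%N, K (k + n)%N &
      forall j, I j -> alph S (k + n).-1 j ->
        (1 <= adm_prod R S k n.-1 (o k) j)%E].

Definition is_return_time (R : realType) (S : shift_data) (I K : set nat)
    (o m : nat -> nat) : Prop :=
  forall k, reaches_I R S I K o k (m k) /\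
            forall n, reaches_I R S I K o k n -> (m k <= n)%N.

Definition is_word_family (S : shift_data) (I : set nat) (o m : nat -> nat)
    (U : nat -> set (seq nat)) : Prop :=
  forall k, [/\ finite_set (U k), U k `<=` words S k (m k) &
    forall j, I j -> alph S (k + m k).-1 j ->
      exists w, [/\ U k w, head 0%N w = o k & last 0%N w = j]].

Definition is_word_choice (S : shift_data) (I : set nat) (o m : nat -> nat)
    (U : nat -> set (seq nat)) (u : nat -> seqspace -> seq nat) : Prop :=
  forall k x, Sigma S (k + m k) x ->
    [/\ U k (u k x), head 0%N (u k x) = o k, I (last 0%N (u k x)) &
        (iter (m k) shiftmap @` cyl S k (u k x)) x].

Definition Cconst (R : realType) (S : shift_data) (phi : nat -> seqspace -> R)
    (m : nat -> nat) (u : nat -> seqspace -> seq nat) (k : nat) : R :=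
  inf [set expR (birkhoff phi (m k) k (prepend (u k x) x))
        | x in Sigma S (k + m k)].

Definition tconst (R : realType) (S : shift_data) (phi : nat -> seqspace -> R)
    (r beta : R) (m : nat -> nat) (u : nat -> seqspace -> seq nat)
    (nn : nat -> nat) (k : nat) : R :=
  Num.max beta
    (1 - (1 - r ^+ nn k * alphaconst S phi r beta k)
         * Cconst S phi m u (k + nn k) / Bconst S phi r (k + nn k)).

(* Main.v *)
(* Call f regular at level k, with parameters (c, D, l), if c <= f <= c + D on
   Sigma_k and if f x - f y <= D (1 - e^{-b d} (1 - l d)^+) whenever x and y have
   the same first letter, where d = d_r(x, y) and b = ln B_k. Comparing the
   weights of the preimages of x and y letter by letter shows that L_k maps
   (c, D, l)-regular functions at level k to (c, D, r l)-regular functions at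
   level k + 1. After n_k steps l = r^{n_k} alpha_k < 1; m_{k + n_k} further
   steps give any two points preimages with the same first letter, of weight at
   least C_{k + n_k}. So in N = n_k + m_{k + n_k} steps the smallest D with
   |f x - f y| <= D min(1, alpha_k d) is multiplied by at most t_k, and
   sup t_k < 1 forces the oscillation of L_k^n f to 0. By invariance mu_k(f) is
   the mean of L_k^n f under mu_{k + n}, which gives the convergence; uniqueness
   follows by applying it to the indicators of cylinders. *)

Require Import Defs.
From HB Require Import structures.
From mathcomp Require Import all_boot all_order all_algebra.
From mathcomp Require Import all_classical all_reals all_analysis.
From mathcomp Require Import ring lra.

Set Implicit Arguments.
Unset Strict Implicit.
Unset Printing Implicit Defensive.

Import Order.TTheory GRing.Theory Num.Theory.
Import numFieldNormedType.Exports.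
Local Open Scope classical_set_scope.
Local Open Scope ring_scope.

(** * Unordered sums and preimages under the shift *)

Lemma esumZl (R : realType) (T : choiceType) (D : set T) (c : R)
    (a : T -> \bar R) : 0 < c -> (forall i, (0 <= a i)%E) ->
  (\esum_(i in D) (c%:E * a i) = c%:E * \esum_(i in D) a i)%E.
Proof.
have le_esumZ (d : R) (b : T -> \bar R) : 0 < d -> (forall i, (0 <= b i)%E) ->
    (\esum_(i in D) (d%:E * b i) <= d%:E * \esum_(i in D) b i)%E.
  move=> d0 b0; apply: ge_ereal_sup => _ [F [finF FD] <-].
  rewrite -ge0_mule_fsumr// lee_wpmul2l ?(lee_fin, ltW d0)//.
  by apply: esum_ge; exists F.
move=> c0 a0; apply/eqP; rewrite eq_le le_esumZ//=.
(* The reverse bound is [le_esumZ] again, for the scalar [c^-1] and the family [c%:E * a i]. *)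
rewrite -lee_pdivlMl//.
apply: le_trans (le_esumZ c^-1 _ _ _); rewrite ?invr_gt0//.
  by apply: le_esum => i _; rewrite muleA -EFinM mulVf ?gt_eqF// mul1e.
by move=> i; rewrite mule_ge0// lee_fin ltW.
Qed.

(** [rsum] splits a family by sign. Additivity on summable families makes any other splitting into
    nonnegative summable parts just as good, so signs need not be tracked later. *)
Lemma rsumB (R : realType) (D : set seqspace) (g a b : seqspace -> R) :
  (forall y, D y -> 0 <= a y) -> (forall y, D y -> 0 <= b y) ->
  (\esum_(y in D) (a y)%:E < +oo)%E -> (\esum_(y in D) (b y)%:E < +oo)%E ->
  (forall y, D y -> g y = a y - b y) ->
  rsum D g = fine (\esum_(y in D) (a y)%:E) - fine (\esum_(y in D) (b y)%:E).
Proof.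
move=> a0 b0 aoo boo gab.
have summableE' (h : seqspace -> R) : (forall y, D y -> 0 <= h y) ->
    (\esum_(y in D) (h y)%:E < +oo)%E -> esum.summable D (EFin \o h).
  move=> h0 hoo; rewrite /esum.summable (eq_esum (b := EFin \o h))//.
  by move=> y /h0 hy; rewrite /= ger0_norm.
have sa := summableE' _ a0 aoo; have sb := summableE' _ b0 boo.
have fine_esum (h : seqspace -> R) : (forall y, D y -> 0 <= h y) ->
    esum.summable D (EFin \o h) -> (\esum_(y in D) (h y)%:E)%E \is a fin_num.
  move=> h0; rewrite summableE (eq_esum (b := EFin \o h))//.
  by move=> y /h0 hy; rewrite /= ger0_norm.
have sg : esum.summable D (EFin \o g).
  rewrite /esum.summable (eq_esum (b := fun y =>
    `|((EFin \o a) \- (EFin \o b))%E y|%E)); last first.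
    by move=> y Dy; rewrite /= gab.
  exact: summableB.
have gpos : (\esum_(y in D) (Num.max (g y) 0)%:E =
    \esum_(y in D) ((EFin \o a) \- (EFin \o b))%E^\+ y)%E.
  by apply: eq_esum => y Dy; rewrite funeposE gab// EFin_max.
have gneg : (\esum_(y in D) (Num.max (- g y) 0)%:E =
    \esum_(y in D) ((EFin \o a) \- (EFin \o b))%E^\- y)%E.
  by apply: eq_esum => y Dy; rewrite funenegE gab// EFin_max.
have fpos : (\esum_(y in D) (Num.max (g y) 0)%:E)%E \is a fin_num.
  apply: fine_esum; first by move=> y _; rewrite le_max lexx orbT.
  move: (summable_funepos sg); rewrite /esum.summable.
  by under eq_esum do rewrite funeposE /= -EFin_max.
have fneg : (\esum_(y in D) (Num.max (- g y) 0)%:E)%E \is a fin_num.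
  apply: fine_esum; first by move=> y _; rewrite le_max lexx orbT.
  move: (summable_funeneg sg); rewrite /esum.summable.
  by under eq_esum do rewrite funenegE /= -EFin_max.
rewrite /rsum -!fineB//; try exact: fine_esum.
by rewrite gpos gneg (esumB sa sb).
Qed.

Definition scons (a : nat) (x : seqspace) : seqspace :=
  fun i => if i is j.+1 then x j else a.

Definition preletters (S : shift_data) (k : nat) (x : seqspace) : set nat :=
  [set a | Sigma S k (scons a x)].

Lemma scons_shiftmap x : scons (x 0%N) (shiftmap x) = x.
Proof. by apply/funext => -[]. Qed.

Lemma Sigma_shift S k x : Sigma S k x -> Sigma S k.+1 (shiftmap x).
Proof. by move=> kx i; have := kx i.+1; rewrite /shiftmap !addSnnS. Qed.

Lemma Sigma_scons S k a x : Sigma S k.+1 x ->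
  Sigma S k (scons a x) <-> alph S k a /\ adm S k a (x 0%N).
Proof.
move=> kx; split; first by move=> /(_ 0%N); rewrite addn0 => -[].
move=> [ka ax] [|i]; last by have := kx i; rewrite !addSnnS.
by rewrite !addn0; split=> //; have [] := kx 0%N; rewrite addn0.
Qed.

(** Admissibility of a prepended letter involves only the letter next to it. This is what allows
    preimages of two points to be matched one by one. *)
Lemma preletters_head S k x y : Sigma S k.+1 x -> Sigma S k.+1 y ->
  x 0%N = y 0%N -> preletters S k x = preletters S k y.
Proof.
move=> kx ky xy; apply/seteqP.
by split=> a /=; rewrite /preletters/= !Sigma_scons// xy.
Qed.

Lemma preimage_shiftE S k x :
  [set y | Sigma S k y /\ shiftmap y = x] = scons^~ x @` preletters S k x.
Proof.
apply/seteqP; split => [y [ky <-]|_ [a ka <-]] //.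
by exists (y 0%N); rewrite /preletters/= scons_shiftmap.
Qed.

Lemma esum_preimage (R : realType) S k x (g : seqspace -> \bar R) :
  (\esum_(y in [set y | Sigma S k y /\ shiftmap y = x]) g y =
   \esum_(a in preletters S k x) g (scons a x))%E.
Proof.
rewrite preimage_shiftE esum_image// => a b _ _ /(congr1 (fun z => z 0%N)).
by [].
Qed.

(** * Normalized Ruelle operators *)

Section normalized_ruelle.
Context (R : realType) (S : shift_data) (phi : nat -> seqspace -> R).
Implicit Types (x y z : seqspace) (g h : seqspace -> R) (c s D : R).

Hypothesis ruelle1 : forall n x, Sigma S n.+1 x -> ruelle S phi n (fun=> 1) x = 1.

(** The Ruelle sum for nonnegative [h], indexed by first letters instead of preimages, so that the
    sums at two points can share an index set. *)
Definition letter_esum k x h : \bar R :=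
  \esum_(a in preletters S k x) (expR (phi k (scons a x)) * h (scons a x))%:E.

Lemma letter_esum1 k x : Sigma S k.+1 x -> letter_esum k x (fun=> 1) = 1%E.
Proof.
move=> kx; have := ruelle1 kx; rewrite /ruelle /rsum.
rewrite [X in _ - fine X]esum1 ?subr0 => [|y _]; last first.
  by rewrite mulr1 max_r// oppr_le0 expR_ge0.
rewrite esum_preimage /letter_esum.
under eq_esum do rewrite max_l ?mulr1 ?expR_ge0//.
under [in X in _ -> X]eq_esum do rewrite mulr1.
(* [fine] sends an infinite sum to 0, which the value 1 rules out. *)
by case: (\esum_(_ in _) _)%E => //= [? ->|/esym/eqP|/esym/eqP];
  rewrite ?oner_eq0.
Qed.

Lemma preletters_neq0 k x : Sigma S k.+1 x -> preletters S k x !=set0.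
Proof.
move=> /letter_esum1; rewrite /letter_esum => kx1; apply/set0P/eqP => k0.
by move: kx1; rewrite k0 esum_set0 => -[] /esym/eqP; rewrite oner_eq0.
Qed.

Lemma letter_esum_cst k x D : Sigma S k.+1 x -> 0 <= D ->
  letter_esum k x (fun=> D) = D%:E.
Proof.
rewrite /letter_esum => kx; rewrite le_eqVlt => /orP[/eqP<-|D0].
  by apply: esum1 => a _; rewrite mulr0.
rewrite (eq_esum (b := fun a => D%:E * (expR (phi k (scons a x)) * 1)%:E)%E).
  rewrite esumZl//.
  by rewrite -[X in (_ * X)%E]/(letter_esum k x (fun=> 1)) letter_esum1// mule1.
by move=> a _; rewrite -EFinM mulr1 mulrC.
Qed.

Lemma letter_esumD k x g h :
  (forall y, Sigma S k y -> 0 <= g y) -> (forall y, Sigma S k y -> 0 <= h y) ->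
  letter_esum k x (fun y => g y + h y) =
  (letter_esum k x g + letter_esum k x h)%E.
Proof.
move=> g0 h0; rewrite /letter_esum -esumD.
- by apply: eq_esum => a _; rewrite mulrDr EFinD.
- by move=> a /g0 ?; rewrite lee_fin mulr_ge0// expR_ge0.
- by move=> a /h0 ?; rewrite lee_fin mulr_ge0// expR_ge0.
Qed.

Lemma letter_esum_fin k x h D : Sigma S k.+1 x ->
  (forall y, Sigma S k y -> 0 <= h y <= D) ->
  letter_esum k x h \is a fin_num.
Proof.
move=> kx h0D; rewrite ge0_fin_numE; last first.
  apply: esum_ge0 => a /h0D/andP[ha _].
  by rewrite lee_fin mulr_ge0// expR_ge0.
apply: (@le_lt_trans _ _ `|D|%:E); last exact: ltry.
rewrite -(letter_esum_cst kx)//; apply: le_esum => a /h0D/andP[ha hD].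
by rewrite lee_fin ler_wpM2l ?expR_ge0// (le_trans hD)// ler_norm.
Qed.

(** Since the weights sum to 1, the constant [c] comes out of the operator and a sum of nonnegative
    terms remains. *)
Lemma ruelle_from_below k x g c s : Sigma S k.+1 x ->
  (forall y, Sigma S k y -> c <= g y <= s) ->
  ruelle S phi k g x = c + fine (letter_esum k x (fun y => g y - c)).
Proof.
move=> kx gcs.
have gc0 y : Sigma S k y -> 0 <= g y - c <= s - c.
  by move=> /gcs /andP[cg gs]; lra.
pose cp := Num.max c 0; pose cm := Num.max (- c) 0.
(* Writing [c] as [cp - cm] exhibits [g] as [(g - c + cp) - cm], a difference of nonnegative
   functions as [rsumB] requires. *)
have cE : c = cp - cm by rewrite /cp /cm; do 2 case: leP => ?; lra.
have cp0 : 0 <= cp by rewrite le_max lexx orbT.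
have cm0 : 0 <= cm by rewrite le_max lexx orbT.
have lty h D : (forall y, Sigma S k y -> 0 <= h y <= D) ->
    (letter_esum k x h < +oo)%E.
  by move=> h0D; rewrite ltey_eq (letter_esum_fin kx h0D).
rewrite /ruelle (@rsumB _ _ _ (fun y => expR (phi k y) * (g y - c + cp))
  (fun y => expR (phi k y) * cm)).
- rewrite !(esum_preimage _ _ _ (fun z => (expR (phi k z) * _)%:E)).
  rewrite -/(letter_esum k x (fun y => g y - c + cp)).
  rewrite -/(letter_esum k x (fun=> cm)) letter_esum_cst// letter_esumD//; last first.
    by move=> y /gc0/andP[].
  rewrite letter_esum_cst// fineD//= ?(letter_esum_fin kx gc0)//.
  by rewrite {2}cE; lra.
- by move=> y [/gc0/andP[? _] _]; rewrite mulr_ge0 ?expR_ge0// addr_ge0.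
- by move=> y _; rewrite mulr_ge0 ?expR_ge0.
- rewrite (esum_preimage _ _ _ (fun z => (expR (phi k z) * (g z - c + cp))%:E)).
  by apply: (lty (fun z => g z - c + cp) (s - c + cp)) => y /gc0; lra.
- rewrite (esum_preimage _ _ _ (fun z => (expR (phi k z) * cm)%:E)).
  by apply: (lty (fun=> cm) cm) => y _; rewrite cm0/=.
- by move=> y _; rewrite -mulrBr; congr (_ * _); rewrite {1}cE; lra.
Qed.

Lemma ruelle_from_above k x g c s : Sigma S k.+1 x ->
  (forall y, Sigma S k y -> c <= g y <= s) ->
  ruelle S phi k g x = s - fine (letter_esum k x (fun y => s - g y)).
Proof.
move=> kx gcs; rewrite (ruelle_from_below kx gcs).
have bnd1 y : Sigma S k y -> 0 <= g y - c <= s - c by move=> /gcs; lra.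
have bnd2 y : Sigma S k y -> 0 <= s - g y <= s - c by move=> /gcs; lra.
(* The order of the two bounds is read off at a preimage of [x], which exists by normalization. *)
have cs : 0 <= s - c by have [a /gcs] := preletters_neq0 kx; lra.
have : letter_esum k x (fun y => (g y - c) + (s - g y)) = (s - c)%:E.
  rewrite -(letter_esum_cst kx cs); apply: eq_esum => a _.
  by congr ((_ * _)%:E); lra.
rewrite letter_esumD => [|y /bnd1/andP[]|y /bnd2/andP[]]//.
move=> /(congr1 fine); rewrite fineD ?(letter_esum_fin kx bnd1)//=.
  by lra.
exact: (letter_esum_fin kx bnd2).
Qed.

Lemma fine_letter_esum_ge0 k x h : (forall y, Sigma S k y -> 0 <= h y) ->
  0 <= fine (letter_esum k x h).
Proof.
move=> h0; apply: fine_ge0; apply: esum_ge0 => a /h0 ?.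
by rewrite lee_fin mulr_ge0 ?expR_ge0.
Qed.

Lemma fine_letter_esum_ge k x h D a : Sigma S k.+1 x ->
  (forall y, Sigma S k y -> 0 <= h y <= D) -> preletters S k x a ->
  expR (phi k (scons a x)) * h (scons a x) <= fine (letter_esum k x h).
Proof.
move=> kx h0D xa; rewrite -lee_fin fineK ?(letter_esum_fin kx h0D)//.
apply: esum_ge; exists [set a]; last by rewrite fsbig_set1.
by split => // _ ->.
Qed.

Lemma ruelle_bounds k x g c s : Sigma S k.+1 x ->
  (forall y, Sigma S k y -> c <= g y <= s) -> c <= ruelle S phi k g x <= s.
Proof.
move=> kx gcs; apply/andP; split.
  rewrite (ruelle_from_below kx gcs) lerDl; apply: fine_letter_esum_ge0 => y.
  by move=> /gcs; lra.
rewrite (ruelle_from_above kx gcs) gerBl; apply: fine_letter_esum_ge0 => y.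
by move=> /gcs; lra.
Qed.

(** All terms of the sum of [s - g] are nonnegative; only that of the preimage [z] is kept. *)
Lemma ruelle_upper k z g c s : Sigma S k z ->
  (forall y, Sigma S k y -> c <= g y <= s) ->
  ruelle S phi k g (shiftmap z) <= s - expR (phi k z) * (s - g z).
Proof.
move=> kz gcs; have kz1 := Sigma_shift kz.
rewrite (ruelle_from_above kz1 gcs) lerD2l lerN2.
have := @fine_letter_esum_ge _ _ (fun y => s - g y) (s - c) (z 0%N) kz1.
rewrite /preletters /= scons_shiftmap; apply => // y /gcs; lra.
Qed.

Lemma ruelle_lower k z g c s : Sigma S k z ->
  (forall y, Sigma S k y -> c <= g y <= s) ->
  c + expR (phi k z) * (g z - c) <= ruelle S phi k g (shiftmap z).
Proof.
move=> kz gcs; have kz1 := Sigma_shift kz.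
rewrite (ruelle_from_below kz1 gcs) lerD2l.
have := @fine_letter_esum_ge _ _ (fun y => g y - c) (s - c) (z 0%N) kz1.
rewrite /preletters /= scons_shiftmap; apply => // y /gcs; lra.
Qed.

(* The weights at [x] dominate [theta] times those at [y]; coupling the two
   families along equal first letters costs at most [1 - theta] of mass. *)
Lemma ruelle_two_points k x y g c D E theta :
  Sigma S k.+1 x -> Sigma S k.+1 y -> x 0%N = y 0%N ->
  (forall z, Sigma S k z -> c <= g z <= c + D) -> 0 < theta <= 1 -> E <= D ->
  (forall a, preletters S k x a ->
     theta * expR (phi k (scons a y)) <= expR (phi k (scons a x)) /\
     g (scons a x) - g (scons a y) <= E) ->
  ruelle S phi k g x - ruelle S phi k g y <= D - theta * (D - E).
Proof.
move=> kx ky xy gcD /andP[theta0 theta1] ED xyE.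
have bnd1 z : Sigma S k z -> 0 <= c + D - g z <= D by move=> /gcD; lra.
have bnd2 z : Sigma S k z -> 0 <= g z - c <= D by move=> /gcD; lra.
rewrite (ruelle_from_above kx gcD) (ruelle_from_below ky gcD).
suff : theta * (D - E) <= fine (letter_esum k x (fun z => c + D - g z)) +
                         fine (letter_esum k y (fun z => g z - c)) by lra.
have fx := letter_esum_fin kx bnd1; have fy := letter_esum_fin ky bnd2.
rewrite -fineD// -lee_fin fineK ?fin_numD ?fx ?fy//.
(* The constant [theta * (D - E)] is spread over the letters with the weights at [y], so a termwise
   comparison suffices. *)
rewrite -(letter_esum_cst ky); last by rewrite mulr_ge0 ?subr_ge0 ?(ltW theta0).
rewrite /letter_esum -(preletters_head kx ky xy) -esumD.
- apply: le_esum => a xa; rewrite -EFinD lee_fin.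
  have ya : preletters S k y a by rewrite -(preletters_head kx ky xy).
  case: (xyE a xa) => pq gE.
  have [/andP[u0 _] /andP[v0 _]] := (bnd1 _ xa, bnd2 _ ya).
  set p := expR (phi k (scons a x)) in pq *.
  set q := expR (phi k (scons a y)) in pq *.
  have q0 : 0 < q by exact: expR_gt0.
  have thq0 : 0 <= theta * q by rewrite mulr_ge0 ?ltW.
  (* Both weights [p] and [q] are at least [theta * q], and the two gaps add up to [D] minus the
     difference of the values of [g], hence to at least [D - E]. *)
  apply: (@le_trans _ _ (theta * q * (c + D - g (scons a x)) +
                         theta * q * (g (scons a y) - c))).
    rewrite -mulrDr mulrCA mulrA [theta * q]mulrC ler_wpM2l//; last by lra.
    by rewrite mulrC.
  by rewrite lerD// ler_wpM2r// ler_piMl// ltW.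
- by move=> a /bnd1/andP[? _]; rewrite lee_fin mulr_ge0 ?expR_ge0.
- move=> a xa; have : preletters S k y a by rewrite -(preletters_head kx ky xy).
  by move=> /bnd2/andP[? _]; rewrite lee_fin mulr_ge0 ?expR_ge0.
Qed.

End normalized_ruelle.

(** * Regularity and oscillation *)

Section seqdist.
Context (R : realType) (r : R).
Hypothesis r01 : 0 < r < 1.
Implicit Types x y : seqspace.

Variant seqdist_spec x y : R -> Prop :=
| SeqdistEq of x = y : seqdist_spec x y 0
| SeqdistNeq n of x n <> y n & (forall i, (i < n)%N -> x i = y i) :
    seqdist_spec x y (r ^+ n).

Lemma seqdistP x y : seqdist_spec x y (seqdist r x y).
Proof.
rewrite /seqdist; case: pselect => [xy|xy].
  case: ex_minnP => n /eqP xyn nmin; apply: SeqdistNeq => // i ni.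
  by apply: contrapT => /eqP /nmin; rewrite leqNgt ni.
apply: SeqdistEq; apply/funext => i; apply: contrapT => /eqP xyi.
by apply: xy; exists i.
Qed.

Lemma seqdist_eq_exp x y n : x n <> y n -> (forall i, (i < n)%N -> x i = y i) ->
  seqdist r x y = r ^+ n.
Proof.
move=> xyn ltn; case: seqdistP => [xy|p xyp ltp]; first by rewrite xy in xyn.
case: (ltngtP n p) => [/ltp//|/ltn//|->//].
Qed.

Lemma seqdist_itv x y : 0 <= seqdist r x y <= 1.
Proof.
case: seqdistP => [_|n _ _]; first by rewrite lexx ler01.
by case/andP: r01 => r0 r1; rewrite exprn_ge0 ?exprn_ile1// ltW.
Qed.

Lemma seqdist_scons a x y :
  seqdist r (scons a x) (scons a y) = r * seqdist r x y.
Proof.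
case: (seqdistP x y) => [->|n xyn ltn].
  rewrite mulr0; case: seqdistP => // n; by [].
by rewrite (@seqdist_eq_exp _ _ n.+1) ?exprS// => -[|i]//= /ltn.
Qed.

Lemma seqdist_head x y : x 0%N <> y 0%N -> seqdist r x y = 1.
Proof. by move=> xy; rewrite (@seqdist_eq_exp _ _ 0). Qed.

(** With [i] the first index of disagreement, the common prefix of length [i >= 2] is a word tested
    by the variation. Every admissible [kappa] thus bounds the quotient by [r ^+ i], and so does
    their infimum. *)
Lemma locally_holder_le S n f z w : locally_holder S r n 2 f ->
  Sigma S n z -> Sigma S n w -> z 0%N = w 0%N -> z 1%N = w 1%N ->
  `|f z - f w| <= holder_constant S r n 2 f * seqdist r z w.
Proof.
move=> hf nz nw zw0 zw1; have [r0 _] := andP r01.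
case: seqdistP => [->|i zwi lti]; first by rewrite subrr normr0 mulr0.
have i2 : (2 <= i)%N by case: i zwi {lti} => [|[|]].
rewrite -ler_pdivrMr ?exprn_gt0//.
apply: lb_le_inf => //= kappa [_ /(_ i i2) kV].
rewrite ler_pdivrMr ?exprn_gt0// -lee_fin; apply: le_trans kV.
apply: ereal_sup_ubound; exists (mkseq z i), z, w; split => //.
- split; first by rewrite size_mkseq.
  + by move=> j ji; rewrite nth_mkseq//; have [] := nz j.
  + by move=> j ji; rewrite !nth_mkseq ?(ltnW ji)//; have [] := nz j.
- by split=> // j; rewrite size_mkseq => ji; rewrite nth_mkseq.
- by split=> // j; rewrite size_mkseq => ji; rewrite nth_mkseq// -lti.
Qed.

Lemma holder_constant_ge0 S n m f : 0 <= holder_constant S r n m f.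
Proof.
rewrite /holder_constant; have [->|/set0P h0] := eqVneq (holder_bounds S r n m f) set0.
  by rewrite inf0.
by apply: lb_le_inf => // x [].
Qed.

End seqdist.

(** * Propagation of regularity under the operators *)

Section regularity.
Context (R : realType) (S : shift_data) (phi : nat -> seqspace -> R) (r : R).
Implicit Types (x y z : seqspace) (f g : seqspace -> R) (c s D l : R).

Hypothesis ruelle1 : forall n x, Sigma S n.+1 x -> ruelle S phi n (fun=> 1) x = 1.
Hypothesis r01 : 0 < r < 1.
Hypothesis phi_holder : forall n, locally_holder S r n 2 (phi n).

Definition logB k : R :=
  \sum_(1 <= i < k.+1) holder_constant S r (k - i)%N 2 (phi (k - i)%N) * r ^+ i.

(** This recursion is what makes the exponential factor in [regular] reproduce itself: it adds the
    distortion of [phi k] and rescales by [r], as prepending a letter rescales distances. *)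
Lemma logBS k : logB k.+1 = r * (logB k + holder_constant S r k 2 (phi k)).
Proof.
rewrite /logB big_ltn// subSS subn0 expr1 addrC mulrDr mulrC; congr (_ + _).
by rewrite big_add1/= big_distrr/=; apply: eq_bigr => i _; rewrite subSS exprS mulrCA.
Qed.

Lemma logB_ge0 k : 0 <= logB k.
Proof.
apply: sumr_ge0 => i _; rewrite mulr_ge0 ?holder_constant_ge0//.
by rewrite exprn_ge0//; case/andP: r01 => /ltW.
Qed.

Definition regular k g c D l : Prop :=
  (forall x, Sigma S k x -> c <= g x <= c + D) /\
  forall x y, Sigma S k x -> Sigma S k y -> x 0%N = y 0%N ->
    g x - g y <= D * (1 - expR (- (logB k * seqdist r x y)) *
                          Num.max (1 - l * seqdist r x y) 0).

Lemma regular_step k g c D l : 0 <= D -> 0 <= l ->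
  regular k g c D l -> regular k.+1 (ruelle S phi k g) c D (r * l).
Proof.
move=> D0 l0 [gcD greg]; split=> [x kx|x y kx ky xy]; first exact: ruelle_bounds.
set d := seqdist r x y; have [d0 d1] := andP (seqdist_itv r01 x y).
rewrite -/d in d0 d1; have [r0 r1] := andP r01.
set h := holder_constant S r k 2 (phi k).
have h0 : 0 <= h by exact: holder_constant_ge0.
have rd0 : 0 <= r * d by rewrite mulr_ge0// ltW.
set e := expR (- (logB k * (r * d))) * Num.max (1 - l * (r * d)) 0.
have e0 : 0 <= e by rewrite mulr_ge0 ?expR_ge0// le_max lexx orbT.
(* [th] bounds the ratio of the weights at matched preimages, which lie at distance [r * d]. The
   coupling turns the factor [e] into [th * e], the factor required at level [k.+1]. *)
set th := expR (- (h * (r * d))).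
have -> : D * (1 - expR (- (logB k.+1 * d)) * Num.max (1 - r * l * d) 0) =
          D - th * (D - D * (1 - e)).
  rewrite logBS -/h.
  have -> : - (r * (logB k + h) * d) = - (h * (r * d)) + - (logB k * (r * d)).
    by ring.
  rewrite expRD -/th (mulrC r l) -(mulrA l r d) /e; ring.
apply: (ruelle_two_points ruelle1 kx ky xy gcD).
- by rewrite expR_gt0/= expR_le1 oppr_le0 mulr_ge0.
- by rewrite ler_piMr// lerBlDr lerDl.
- move=> a xa; have ya : preletters S k y a by rewrite -(preletters_head kx ky xy).
  have zE : seqdist r (scons a x) (scons a y) = r * d by exact: seqdist_scons.
  split; last by rewrite /e -zE; apply: greg.
  rewrite -expRD ler_expR addrC lerBlDr -lerBlDl.
  (* The preimages share the letter [a] and the first letter of [x] and [y], hence two letters, as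
     index 2 demands. *)
  have := @locally_holder_le _ _ r01 _ _ _ (scons a x) (scons a y) (phi_holder k) xa ya erefl xy.
  by rewrite zE -/h ler_norml => /andP[+ _]; lra.
Qed.

Lemma regular_iter k g c D l n : 0 <= D -> 0 <= l ->
  regular k g c D l -> regular (k + n) (ruelle_iter S phi k n g) c D (r ^+ n * l).
Proof.
move=> D0 l0 kg; elim: n => [|n IH]; first by rewrite addn0 mul1r.
rewrite addnS exprS -mulrA; apply: regular_step => //.
by rewrite mulr_ge0// exprn_ge0//; case/andP: r01 => /ltW.
Qed.

Lemma Sigma_iter_shift k n z : Sigma S k z -> Sigma S (k + n) (iter n shiftmap z).
Proof.
by move=> kz; elim: n => [|n IH]; rewrite ?addn0// addnS; exact: Sigma_shift.
Qed.

Lemma ruelle_iter_bounds k g c s n x :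
  (forall y, Sigma S k y -> c <= g y <= s) -> Sigma S (k + n) x ->
  c <= ruelle_iter S phi k n g x <= s.
Proof.
move=> gcs; elim: n x => [|n IH] x; first by rewrite addn0; exact: gcs.
by rewrite addnS => kx; exact: ruelle_bounds.
Qed.

Lemma birkhoffS k n z :
  birkhoff phi n.+1 k z = birkhoff phi n k z + phi (k + n)%N (iter n shiftmap z).
Proof. by rewrite /birkhoff big_ord_recr. Qed.

(** Following the single orbit of [z], the gap below [s] is multiplied by one weight per step; the
    product of the weights is the exponential of the Birkhoff sum. *)
Lemma ruelle_iter_upper k g c s n z : Sigma S k z ->
  (forall y, Sigma S k y -> c <= g y <= s) ->
  ruelle_iter S phi k n g (iter n shiftmap z) <=
  s - expR (birkhoff phi n k z) * (s - g z).
Proof.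
move=> kz gcs; elim: n => [|n IH].
  by rewrite /birkhoff big_ord0 expR0 mul1r/=; lra.
rewrite birkhoffS [birkhoff _ _ _ _ + _]addrC expRD.
have knz := Sigma_iter_shift n kz.
have bnd y : Sigma S (k + n) y -> c <= ruelle_iter S phi k n g y <= s.
  exact: ruelle_iter_bounds.
apply: (le_trans (ruelle_upper ruelle1 knz bnd)).
rewrite lerD2l lerN2 -mulrA ler_wpM2l ?expR_ge0//; lra.
Qed.

Lemma ruelle_iter_lower k g c s n z : Sigma S k z ->
  (forall y, Sigma S k y -> c <= g y <= s) ->
  c + expR (birkhoff phi n k z) * (g z - c) <=
  ruelle_iter S phi k n g (iter n shiftmap z).
Proof.
move=> kz gcs; elim: n => [|n IH].
  by rewrite /birkhoff big_ord0 expR0 mul1r/=; lra.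
rewrite birkhoffS [birkhoff _ _ _ _ + _]addrC expRD.
have knz := Sigma_iter_shift n kz.
have bnd y : Sigma S (k + n) y -> c <= ruelle_iter S phi k n g y <= s.
  exact: ruelle_iter_bounds.
apply: (le_trans _ (ruelle_lower ruelle1 knz bnd)).
rewrite lerD2l -mulrA ler_wpM2l ?expR_ge0//; lra.
Qed.

Lemma ruelle_iterD k n p g :
  ruelle_iter S phi k (n + p) g = ruelle_iter S phi (k + n) p (ruelle_iter S phi k n g).
Proof. by elim: p => [|p IH]; rewrite ?addn0// addnS/= IH addnA. Qed.

End regularity.

(** * Contraction of the oscillation over blocks of steps *)

Lemma exists_expr_le (R : realType) (t D eps : R) : 0 <= t < 1 -> 0 < eps ->
  exists j, t ^+ j * D <= eps.
Proof.
move=> /andP[t0 t1] eps0.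
have /cvgrPdist_le/(_ eps eps0) : (fun j => t ^+ j * D) @ \oo --> (0 : R).
  by rewrite -(mul0r D); apply: cvgMl; apply: cvg_expr; rewrite ger0_norm.
move=> [j _ /(_ j (leqnn j))] /=; rewrite sub0r normrN => jeps; exists j.
exact: (le_trans (ler_norm _)).
Qed.

Lemma seqdistC (R : realType) (r : R) (x y : seqspace) :
  seqdist r x y = seqdist r y x.
Proof.
case: (seqdistP r x y) => [->|n xyn ltn]; first by case: seqdistP.
by rewrite (@seqdist_eq_exp _ _ _ _ n) => [//|/esym//|i /ltn].
Qed.

Lemma iter_shiftmapE n (z : seqspace) i : iter n shiftmap z i = z (n + i)%N.
Proof. by elim: n i => [|n IH] i //=; rewrite /shiftmap IH addnS. Qed.

Section contraction.
Context (R : realType) (S : shift_data) (phi : nat -> seqspace -> R) (r beta : R).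
Context (I : set nat) (o m nn : nat -> nat) (U : nat -> set (seq nat)).
Context (u : nat -> seqspace -> seq nat).
Implicit Types (x y z : seqspace) (f g : seqspace -> R) (c s D l : R).

Hypothesis ruelle1 : forall n x, Sigma S n.+1 x -> ruelle S phi n (fun=> 1) x = 1.
Hypothesis r01 : 0 < r < 1.
Hypothesis phi_holder : forall n, locally_holder S r n 2 (phi n).
Hypothesis beta01 : 0 < beta < 1.
Hypothesis m_gt0 : forall k, (0 < m k)%N.
Hypothesis hU : is_word_family S I o m U.
Hypothesis hu : is_word_choice S I o m U u.
Hypothesis hnn : forall k,
  Num.floor (- ln (alphaconst S phi r beta k) / ln r) + 1 <= (nn k)%:Z.

(** The point is [prepend (u k x) x], so its weight belongs to the set whose infimum is [Cconst]. *)
Lemma word_point k x : Sigma S (k + m k) x ->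
  exists z, [/\ Sigma S k z, z 0%N = o k, iter (m k) shiftmap z = x &
                Cconst S phi m u k <= expR (birkhoff phi (m k) k z)].
Proof.
move=> kx; have [ux head_ux _ [z [kz zu] zx]] := hu kx.
have [_ /(_ _ ux)[sz _ _] _] := hU k.
exists z; split => //.
  by rewrite zu ?sz// nth0.
have -> : z = prepend (u k x) x.
  apply/funext => i; rewrite /prepend; case: ltnP => [/zu//|].
  by rewrite sz -[in RHS]zx iter_shiftmapE => /subnKC ->.
apply: ge_inf; last by exists x.
by exists 0 => _ [y _ <-]; exact: expR_ge0.
Qed.

Lemma Cconst_ge0 k : 0 <= Cconst S phi m u k.
Proof.
rewrite /Cconst; set E := (X in inf X).
have [->|/set0P E0] := eqVneq E set0; first by rewrite inf0.
by apply: lb_le_inf => // _ [y _ <-]; exact: expR_ge0.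
Qed.

Lemma BconstE k : Bconst S phi r k = expR (logB S phi r k).
Proof. by []. Qed.

Lemma alphaconst_ge1 k : 1 <= alphaconst S phi r beta k.
Proof.
have [b0 b1] := andP beta01.
rewrite /alphaconst ler_pdivlMr// mul1r BconstE (le_trans (ltW b1))//.
by rewrite -expR0 ler_expR; exact: logB_ge0.
Qed.

(** Taking logarithms and dividing by [ln r < 0] turns this into a lower bound on [nn k]; the [+ 1]
    after the floor makes it strict. *)
Lemma alphaconst_shrinks k : r ^+ nn k * alphaconst S phi r beta k < 1.
Proof.
have [r0 r1] := andP r01.
have a0 : 0 < alphaconst S phi r beta k.
  by rewrite (lt_le_trans ltr01)// alphaconst_ge1.
have := hnn k; move: (alphaconst S phi r beta k) a0 => a a0 hn.
have lnr : ln r < 0 by rewrite ln_lt0// r0 r1.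
rewrite -[_ * _]lnK ?posrE ?mulr_gt0 ?exprn_gt0//.
rewrite expR_lt1 lnM ?posrE ?exprn_gt0// lnXn// -ltrBrDr sub0r.
rewrite -mulr_natr -ltr_ndivrMl// mulrC.
move: hn; rewrite -(ler_int R); apply: lt_le_trans.
exact: floorD1_gt.
Qed.

(** One-sided, since exchanging [x] and [y] yields the absolute value. *)
Definition osc_lip k f D : Prop := forall x y, Sigma S k x -> Sigma S k y ->
  f x - f y <= D * Num.min 1 (alphaconst S phi r beta k * seqdist r x y).

(** With [a] for [alphaconst], the minimum of 1 and [a * d] equals 1 minus the positive part of
    [1 - a * d]; multiplying that part by an exponential at most 1 only weakens the bound. *)
Lemma osc_lip_regular k f D : 0 <= D -> osc_lip k f D ->
  exists c, regular S phi r k f c D (alphaconst S phi r beta k).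
Proof.
move=> D0 fD; have [k0|/set0P[x0 kx0]] := eqVneq (Sigma S k) set0.
  by exists 0; split=> [x|x y]; rewrite k0.
have a1 := alphaconst_ge1 k.
have osc x y : Sigma S k x -> Sigma S k y -> f x - f y <= D.
  move=> kx ky; apply: (le_trans (fD x y kx ky)).
  by rewrite ler_piMr// ge_min lexx.
exists (inf (f @` Sigma S k)); split=> [x kx|x y kx ky _].
  apply/andP; split.
    apply: ge_inf; last by exists x.
    by exists (f x0 - D) => _ [y ky <-]; have := osc _ _ kx0 ky; lra.
  rewrite -lerBlDr; apply: lb_le_inf; first by exists (f x0), x0.
  by move=> _ [y ky <-]; have := osc _ _ kx ky; lra.
apply: (le_trans (fD x y kx ky)); rewrite ler_wpM2l//.
set d := seqdist r x y; have [d0 d1] := andP (seqdist_itv r01 x y).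
set a := alphaconst S phi r beta k in a1 *.
set w := expR _; have w1 : w <= 1.
  by rewrite /w expR_le1 oppr_le0 mulr_ge0// logB_ge0.
have w0 : 0 <= w by exact: expR_ge0.
have [ad|ad] := leP (a * d) 1.
  rewrite max_l ?subr_ge0//.
  have : w * (1 - a * d) <= 1 - a * d by rewrite ler_piMl// subr_ge0.
  by lra.
by rewrite max_r; [rewrite mulr0 subr0|lra].
Qed.

(** If [l * d <= 1], the bound [expR (- (b * d)) >= 1 - b * d] gives the claim after expanding the
    product. Otherwise the left side is 1, already below [l * d]. *)
Lemma modulus_le (b l d : R) : 0 <= b -> 0 <= l -> 0 <= d ->
  1 - expR (- (b * d)) * Num.max (1 - l * d) 0 <= (b + l) * d.
Proof.
move=> b0 l0 d0; have bd0 : 0 <= b * d by rewrite mulr_ge0.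
have [ld|ld] := leP (l * d) 1; last by rewrite max_r ?mulr0; lra.
rewrite max_l ?subr_ge0//.
have : (1 - b * d) * (1 - l * d) <= expR (- (b * d)) * (1 - l * d).
  rewrite ler_wpM2r ?subr_ge0//; have := expR_ge1Dx (- (b * d)); lra.
have : 0 <= b * d * (l * d) by rewrite !mulr_ge0.
by lra.
Qed.

(** Here the division by [beta] in [alphaconst] pays off: [beta] times it is [Bconst], which is at
    least [1 + logB], hence at least the slope [logB + l] of the modulus. *)
Lemma regular_local k g c D l x y : 0 <= D -> 0 <= l <= 1 ->
  regular S phi r k g c D l -> Sigma S k x -> Sigma S k y -> x 0%N = y 0%N ->
  g x - g y <= D * (beta * (alphaconst S phi r beta k * seqdist r x y)).
Proof.
move=> D0 /andP[l0 l1] [_ greg] kx ky xy.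
have [d0 _] := andP (seqdist_itv r01 x y); have [b0 b1] := andP beta01.
apply: (le_trans (greg _ _ kx ky xy)); rewrite ler_wpM2l//.
have lB := logB_ge0 S phi r01 k.
apply: (le_trans (modulus_le lB l0 d0)).
rewrite mulrA ler_wpM2r// /alphaconst (mulrC beta) divfK ?gt_eqF// BconstE.
have := expR_ge1Dx (logB S phi r k); lra.
Qed.

(* Both points have a preimage in the cylinder of [o_k], of weight at least
   [C_k], and these two preimages share their first letter. *)
Lemma regular_global k g c D l x y : 0 <= D -> 0 <= l <= 1 ->
  regular S phi r k g c D l -> Sigma S (k + m k) x -> Sigma S (k + m k) y ->
  ruelle_iter S phi k (m k) g x - ruelle_iter S phi k (m k) g y <=
  (1 - (1 - l) * Cconst S phi m u k / Bconst S phi r k) * D.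
Proof.
move=> D0 /andP[l0 l1] [gc greg] /word_point[zx [kzx zx0 <- Cx]].
move=> /word_point[zy [kzy zy0 <- Cy]].
have ux := ruelle_iter_upper ruelle1 (m k) kzx gc.
have ly := ruelle_iter_lower ruelle1 (m k) kzy gc.
have [/andP[_ gx] /andP[gy _]] := (gc _ kzx, gc _ kzy).
have C0 := Cconst_ge0 k.
set C := Cconst S phi m u k in C0 Cx Cy *; set B := Bconst S phi r k.
(* As distances are at most 1, the exponential factor is at least [B^-1] and the linear one at least
   [1 - l]. *)
have gxy : g zx - g zy <= D * (1 - B^-1 * (1 - l)).
  apply: (le_trans (greg _ _ kzx kzy _)); first by rewrite zx0 zy0.
  have [e0 e1] := andP (seqdist_itv r01 zx zy).
  rewrite ler_wpM2l// lerD2l lerN2 /B BconstE -expRN.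
  apply: ler_pM; rewrite ?expR_ge0 ?subr_ge0//.
    by rewrite ler_expR lerN2 ler_piMr// logB_ge0.
  by rewrite le_max lerD2l lerN2 ler_piMr.
(* Both gaps are nonnegative, so each weight may be lowered to [C]; the gaps then combine into
   [D - (g zx - g zy)]. *)
have Cgx : C * (c + D - g zx) <= expR (birkhoff phi (m k) k zx) * (c + D - g zx).
  by rewrite ler_wpM2r// subr_ge0.
have Cgy : C * (g zy - c) <= expR (birkhoff phi (m k) k zy) * (g zy - c).
  by rewrite ler_wpM2r// subr_ge0.
have : C * (g zx - g zy) <= C * (D * (1 - B^-1 * (1 - l))).
  by rewrite ler_wpM2l.
have -> : (1 - (1 - l) * C / B) * D = D - C * (D - D * (1 - B^-1 * (1 - l))).
  by ring.
by lra.
Qed.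

Lemma osc_lip_contraction k f D t : 0 <= D ->
  tconst S phi r beta m u nn k <= t -> osc_lip k f D ->
  osc_lip (k + (nn k + m (k + nn k)))
    (ruelle_iter S phi k (nn k + m (k + nn k)) f) (t * D).
Proof.
move=> D0; rewrite ge_max => /andP[tbeta tC] fD.
have [c freg] := osc_lip_regular D0 fD.
have [b0 b1] := andP beta01; have [r0 r1] := andP r01.
have a0 : 0 <= alphaconst S phi r beta k by rewrite (le_trans _ (alphaconst_ge1 k)).
have ra1 := ltW (alphaconst_shrinks k).
have ra0 n : 0 <= r ^+ n * alphaconst S phi r beta k.
  by rewrite mulr_ge0// exprn_ge0// ltW.
have regn n := regular_iter ruelle1 r01 phi_holder n D0 a0 freg.
move=> x y; set n := (nn k + _)%N => kx ky.
have [d0 d1] := andP (seqdist_itv r01 x y).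
(* If the minimum is 1, the global estimate applies after the first [nn k] steps. Otherwise the
   distance is below 1, the first letters agree, and the local estimate contributes the factor
   [beta <= t]. *)
have [ad|ad] := leP 1 (alphaconst S phi r beta (k + n) * seqdist r x y).
  rewrite mulr1; apply: (@le_trans _ _ _ _ _ _ (ler_wpM2r D0 tC)).
  move: kx ky; rewrite /n ruelle_iterD addnA => kx ky.
  by apply: regular_global (regn _) kx ky; rewrite ?ra0 ?ra1.
have xy : x 0%N = y 0%N.
  apply: contrapT => /(seqdist_head r) dE; move: ad.
  by rewrite dE mulr1 ltNge alphaconst_ge1.
(* The steps after the first [nn k] only decrease the slope further. *)
have ran : 0 <= r ^+ n * alphaconst S phi r beta k <= 1.
  rewrite ra0/= (le_trans _ ra1)// /n exprD -mulrA mulrCA ler_piMl//.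
  by rewrite exprn_ile1// ltW.
apply: (le_trans (regular_local D0 ran (regn n) kx ky xy)).
move: (alphaconst_ge1 (k + n)) => {ad}; move: (alphaconst _ _ _ _ (k + n)) => a' a'1.
rewrite (mulrC t D) -(mulrA D t) ler_wpM2l// ler_wpM2r// mulr_ge0//.
exact: le_trans a'1.
Qed.

Lemma dr_lipschitz_osc_lip k f : dr_lipschitz r (Sigma S k) f ->
  exists2 D, 0 <= D & osc_lip k f D.
Proof.
move=> [c fc]; exists `|c| => // x y kx ky.
have [d0 d1] := andP (seqdist_itv r01 x y).
apply: (le_trans (ler_norm _)); apply: (le_trans (fc _ _ kx ky)).
apply: (@le_trans _ _ (`|c| * seqdist r x y)).
  by rewrite ler_wpM2r// ler_norm.
by rewrite ler_wpM2l// le_min d1 ler_peMl// alphaconst_ge1.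
Qed.

(** Needed to integrate the iterates. Points with distinct first letters are at distance 1 and cost
    at most [D], whence the summand 1 in the constant; all others are covered by [modulus_le]. *)
Lemma ruelle_iter_lipschitz k f n : dr_lipschitz r (Sigma S k) f ->
  dr_lipschitz r (Sigma S (k + n)) (ruelle_iter S phi k n f).
Proof.
move=> /dr_lipschitz_osc_lip[D D0 /(osc_lip_regular D0)[c freg]].
have a0 : 0 <= alphaconst S phi r beta k by rewrite (le_trans _ (alphaconst_ge1 k)).
have [] := regular_iter ruelle1 r01 phi_holder n D0 a0 freg.
set g := ruelle_iter _ _ _ _ _; set l := _ * alphaconst _ _ _ _ _ => gc greg.
have l0 : 0 <= l by rewrite mulr_ge0// exprn_ge0//; case/andP: r01 => /ltW.
have lB := logB_ge0 S phi r01 (k + n).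
exists (D * (1 + (logB S phi r (k + n) + l))).
have gxy x y : Sigma S (k + n) x -> Sigma S (k + n) y ->
    g x - g y <= D * (1 + (logB S phi r (k + n) + l)) * seqdist r x y.
  move=> kx ky; have [d0 d1] := andP (seqdist_itv r01 x y); rewrite -mulrA.
  have [xy|xy] := pselect (x 0%N = y 0%N).
    apply: (le_trans (greg _ _ kx ky xy)); rewrite ler_wpM2l//.
    by apply: (le_trans (modulus_le lB l0 d0)); rewrite ler_wpM2r// lerDr.
  rewrite seqdist_head// mulr1 (@le_trans _ _ D)//.
    by have [/andP[? ?] /andP[? ?]] := (gc _ kx, gc _ ky); lra.
  by rewrite ler_peMr// lerDl addr_ge0.
move=> x y kx ky; rewrite ler_norml gxy// andbT lerNl opprB seqdistC.
exact: gxy.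
Qed.

(** Contracting blocks are concatenated, the length of each depending on the level where it starts.
    Past the end of the last block the bounds persist because normalized operators preserve them. *)
Lemma osc_decay k f t : 0 <= t < 1 ->
  (forall j, tconst S phi r beta m u nn j <= t) ->
  dr_lipschitz r (Sigma S k) f -> forall eps, 0 < eps ->
  exists N, forall n, (N <= n)%N -> exists c,
    forall x, Sigma S (k + n) x -> c <= ruelle_iter S phi k n f x <= c + eps.
Proof.
move=> /andP[t0 t1] tt /dr_lipschitz_osc_lip[D D0 fD] eps eps0.
have decay j : exists N, osc_lip (k + N) (ruelle_iter S phi k N f) (t ^+ j * D).
  elim: j => [|j [N NfD]]; first by exists 0%N; rewrite addn0 mul1r.
  exists (N + (nn (k + N) + m (k + N + nn (k + N))))%N.
  rewrite ruelle_iterD addnA exprS -mulrA; apply: osc_lip_contraction => //.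
  by rewrite mulr_ge0// exprn_ge0.
have [j tjD] : exists j, t ^+ j * D <= eps.
  by apply: exists_expr_le => //; rewrite t0.
have [N NfD] := decay j; exists N => n Nn.
have tD0 : 0 <= t ^+ j * D by rewrite mulr_ge0// exprn_ge0.
have [c [cf _]] := osc_lip_regular tD0 NfD; exists c => x.
rewrite -(subnKC Nn) ruelle_iterD addnA; apply: ruelle_iter_bounds => // y ky.
by have := cf y ky; lra.
Qed.

End contraction.

(** * Cylinders and measurability *)

Section cylinders.
Implicit Types x y : seqspace.

Definition agree n x y := forall i, (i < n)%N -> y i = x i.

Lemma agree_prefix n x y : agree n x y ->
  agree n y = agree n x.
Proof.
move=> xy; apply/funext => z; apply/propext.
by split=> h i ni; rewrite h// xy.
Qed.

(** Otherwise there are points outside [O] agreeing with [x] on ever longer prefixes; they converge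
    to [x] coordinatewise and so must enter [O]. *)
Lemma open_agree (O : set (prod_topology (fun _ : nat => nat))) x :
  open O -> O x -> exists n, [set y | agree n x y] `<=` O.
Proof.
move=> oO Ox; apply: contrapT => /forallNP nO.
have /choice[g gO] n : exists y, agree n x y /\ ~ O y.
  have /existsNP[y /not_implyP[xy nOy]] := nO n.
  by exists y.
have gx : g @ \oo --> (x : prod_topology (fun _ : nat => nat)).
  apply/cvg_sup => i V [W] [[Z] oZ <-] WfN WV.
  apply: (filterS WV); rewrite nbhs_simpl; exists i.+1 => // n /= ni.
  by rewrite /proj/= (gO n).1.
have [N _ /(_ N (leqnn N))] : (g @ \oo) O by apply: gx; exact: open_nbhs_nbhs.
exact: (gO N).2.
Qed.

(** Cylinders are neighbourhoods: each is a finite intersection of preimages of singletons, open in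
    a discrete factor, under the projections. *)
Lemma agree_open (A : set (prod_topology (fun _ : nat => nat))) :
  (forall x, A x -> exists n, [set y | agree n x y] `<=` A) -> open A.
Proof.
have agree_nbhs n x : nbhs (x : prod_topology (fun _ : nat => nat)) [set y | agree n x y].
  elim: n => [|n IH]; first by apply: filterS filterT => y _ i.
  have := @proj_continuous nat (fun=> nat) n x [set x n].
  move=> /(_ (discrete_set1 _))/(filterI IH); apply: filterS => y [xy /= yn] i.
  by rewrite ltnS leq_eqVlt => /orP[/eqP->//|/xy].
move=> nA; rewrite openE => x /nA[n nAx]; rewrite /interior.
by apply: filterS nAx _; exact: agree_nbhs.
Qed.

Lemma agree_measurable (A : set seqspace) :
  (forall x, A x -> exists n, [set y | agree n x y] `<=` A) -> measurable A.
Proof. by move=> /agree_open; exact: sub_sigma_algebra. Qed.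

Lemma Sigma_measurable S k : measurable (Sigma S k).
Proof.
have -> : Sigma S k = \bigcap_i [set x | [/\ alph S (k + i) (x i),
    alph S (k + i).+1 (x i.+1) & adm S (k + i) (x i) (x i.+1)]].
  by apply/seteqP; split=> [x kx i _|x kx i]; [exact: kx|exact: kx i Logic.I].
apply: bigcapT_measurable => i; apply: agree_measurable => x kx.
by exists i.+2 => y xy /=; rewrite !xy.
Qed.

Lemma dr_lipschitz_measurable (R : realType) (r : R) S k (f : seqspace -> R) :
  0 < r < 1 -> dr_lipschitz r (Sigma S k) f -> measurable_fun (Sigma S k) f.
Proof.
move=> r01 [c fc]; have [r0 r1] := andP r01.
move=> mS; apply: (measurability _ (measurable_realfun.RGenOInfty.measurableE R)) => //.
move=> _ [_ [a ->] <-].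
(* The values of [f] off [Sigma S k] are arbitrary, so [A] tests only points of that set; this makes
   [A] open and leaves its trace on [Sigma S k] unchanged. *)
pose A := [set x | exists n, forall y, Sigma S k y -> agree n x y -> a < f y].
have -> : Sigma S k `&` f @^-1` `]a, +oo[%classic = Sigma S k `&` A.
  apply/seteqP; split=> x /= [kx]; last first.
    by move=> [n /(_ x kx)] => fx; split => //; rewrite in_itv/= andbT fx.
  rewrite in_itv/= andbT => fx; split => //.
  have eps0 : 0 < (f x - a) / 2 by rewrite divr_gt0// subr_gt0.
  have [|n nx] := @exists_expr_le R r `|c| _ _ eps0; first by rewrite ltW.
  exists n => y ky xy; have := fc _ _ kx ky; rewrite ler_norml => /andP[_ fxy].
  have : c * seqdist r x y <= r ^+ n * `|c|.
    have [d0 _] := andP (seqdist_itv r01 x y).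
    rewrite mulrC; apply: (@le_trans _ _ (seqdist r x y * `|c|)).
      by rewrite ler_wpM2l// ler_norm.
    rewrite ler_wpM2r//; case: seqdistP => [_|p xyp _].
      by rewrite exprn_ge0// ltW.
    rewrite ler_wiXn2l ?ltW// leqNgt; apply/negP => /xy.
    exact/nesym.
  lra.
apply: measurableI => //; apply: agree_measurable => x [n nA].
exists n => y xy; exists n => z kz yz; apply: nA => //.
by rewrite -(agree_prefix xy).
Qed.

(** Cylinders of the ambient space, with no admissibility imposed, so that one countable family
    serves all levels. *)
Definition wordset (w : seq nat) : set seqspace :=
  [set x | forall i, (i < size w)%N -> x i = nth 0%N w i].

Lemma wordset_agree w x : wordset w x -> [set y | agree (size w) x y] = wordset w.
Proof.
by move=> wx; apply/seteqP; split=> y xy i iw; rewrite xy// wx.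
Qed.

Lemma measurable_wordset w : measurable (wordset w).
Proof.
by apply: agree_measurable => x wx; exists (size w); rewrite wordset_agree.
Qed.

Lemma wordset_mkseq x n : wordset (mkseq x n) = [set y | agree n x y].
Proof.
by apply/seteqP; split=> y xy i; rewrite ?size_mkseq => ni;
  have := xy i; rewrite ?size_mkseq nth_mkseq//; apply.
Qed.

Definition wordsets : set (set seqspace) := set0 |` range wordset.

(** Two cylinders are nested or disjoint; [set0] was put into the family for the second case. *)
Lemma wordsets_setI : setI_closed wordsets.
Proof.
have wlog_sub w v : (size w <= size v)%N -> wordsets (wordset w `&` wordset v).
  move=> wv; have [->|/set0P[x [wx vx]]] := eqVneq (wordset w `&` wordset v) set0.
    by left.
  right; exists v => //; apply/seteqP; split=> [y vy|y []//]; split => // i iw.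
  by rewrite vy ?(leq_trans iw)// -vx ?(leq_trans iw)// wx.
move=> A B [->|[w _ <-]]; first by rewrite set0I; left.
move=> [->|[v _ <-]]; first by rewrite setI0; left.
by have [/wlog_sub//|/ltnW/wlog_sub] := leqP (size w) (size v); rewrite setIC.
Qed.

Lemma wordsets_generate : <<s @open (prod_topology (fun _ : nat => nat)) >> `<=`
  <<s wordsets >>.
Proof.
apply: smallest_sub; first exact: smallest_sigma_algebra.
move=> O oO.
(* Words whose cylinder leaves [O] contribute [set0], so the union runs over the countable type of
   all words. *)
have -> : O = \bigcup_w (if pselect (wordset w `<=` O) then wordset w else set0).
  apply/seteqP; split=> [x /(open_agree oO)[n nO]|x [w _]].
    exists (mkseq x n) => //; case: pselect => [wO|[]]/=; last by rewrite wordset_mkseq.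
    by rewrite wordset_mkseq.
  by case: pselect => //= wO /wO.
apply: (@countable_bigcupT_measurable _ (g_sigma_algebraType wordsets)) => // w.
apply: sub_sigma_algebra; case: pselect => wO /=; [right; exists w|left] => //.
Qed.

Lemma probability_unique_wordset (R : realType) (P Q : probability seqspace R) :
  (forall w, P (wordset w) = Q (wordset w)) ->
  forall B : set seqspace, measurable B -> P B = Q B.
Proof.
move=> PQ B mB.
apply: (@g_sigma_algebra_measure_unique _ R _ wordsets _ (fun=> setT)) => //.
- by move=> _ [->//|[w _ <-]]; exact: measurable_wordset.
- by move=> _; right; exists [::] => //; apply/seteqP; split.
- by rewrite bigcup_const//; exists 0%N.
- exact: wordsets_setI.
- by move=> _ [->|[w _ <-]]; [rewrite !measure0|exact: PQ].
- by move=> _; exact: (le_lt_trans (probability_le1 P measurableT) (ltry _)).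
- exact: wordsets_generate.
Qed.

End cylinders.

(** * Integration over a set of full mass *)

Lemma probability_setI1 (R : realType) (P : probability seqspace R)
    (A D : set seqspace) :
  measurable A -> measurable D -> P D = 1%E -> P (A `&` D) = P A.
Proof.
move=> mA mD PD; rewrite [RHS](measureDI P mA mD).
rewrite [X in (X + _)%E](_ : _ = 0%E) ?add0e//.
apply/eqP; rewrite -measure_le0.
have -> : 0%E = P (~` D) by rewrite probability_setC// PD subee.
by rewrite setDE measureIr//; exact: measurableC.
Qed.

Lemma Rintegral_itv (R : realType) (P : probability seqspace R)
    (D : set seqspace) (g : seqspace -> R) (c s : R) :
  measurable D -> P D = 1%E -> measurable_fun D g ->
  (forall x, D x -> c <= g x <= s) -> c <= \int[P]_(x in D) g x <= s.
Proof.
move=> mD PD mg gcs.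
have PDoo : (P D < +oo)%E by rewrite PD ltry.
have intg (h : seqspace -> R) M : measurable_fun D h ->
    (forall x, D x -> `|h x| <= M) -> P.-integrable D (EFin \o h).
  move=> mh hM; apply: measurable_bounded_integrable => //.
  exists M; split; first exact: num_real.
  by move=> N MN x Dx; rewrite /= (le_trans (hM x Dx))// ltW.
have ig : P.-integrable D (EFin \o g).
  apply: (intg _ (`|c| + `|s|)) => // x /gcs/andP[cg gs].
  have := ler_norm (- c); have := ler_norm s; rewrite normrN ler_norml.
  by have := normr_ge0 c; have := normr_ge0 s; lra.
have icst a : P.-integrable D (EFin \o (fun=> a)) by exact: (intg _ `|a|).
have cstE a : \int[P]_(x in D) a = a by rewrite Rintegral_cst// [X in fine X]PD mulr1.
apply/andP; split; [rewrite -{1}(cstE c)|rewrite -[leRHS](cstE s)];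
  by apply: le_Rintegral => // x /gcs/andP[].
Qed.

(** * Invariant sequences *)

Section invariant_sequences.
Context (R : realType) (S : shift_data) (phi : nat -> seqspace -> R) (r beta : R).
Context (I : set nat) (o m nn : nat -> nat) (U : nat -> set (seq nat)).
Context (u : nat -> seqspace -> seq nat).

Hypothesis ruelle1 : forall n x, Sigma S n.+1 x -> ruelle S phi n (fun=> 1) x = 1.
Hypothesis r01 : 0 < r < 1.
Hypothesis phi_holder : forall n, locally_holder S r n 2 (phi n).
Hypothesis beta01 : 0 < beta < 1.
Hypothesis m_gt0 : forall k, (0 < m k)%N.
Hypothesis hU : is_word_family S I o m U.
Hypothesis hu : is_word_choice S I o m U u.
Hypothesis hnn : forall k,
  Num.floor (- ln (alphaconst S phi r beta k) / ln r) + 1 <= (nn k)%:Z.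

Lemma dr_lipschitz_bounded k f : dr_lipschitz r (Sigma S k) f ->
  exists M : R, forall x, Sigma S k x -> `|f x| <= M.
Proof.
move=> [c fc]; have [k0|/set0P[x0 kx0]] := eqVneq (Sigma S k) set0.
  by exists 0 => x; rewrite k0.
exists (`|f x0| + `|c|) => x kx; rewrite -[f x](subrK (f x0)) addrC.
rewrite (le_trans (ler_normD _ _))// lerD2l (le_trans (fc _ _ kx kx0))//.
have [d0 d1] := andP (seqdist_itv r01 x x0).
by rewrite (le_trans (ler_wpM2r d0 (ler_norm c)))// ler_piMr.
Qed.

(** Duality is available for bounded measurable functions only; the iterates qualify because they
    remain Lipschitz. *)
Lemma invariant_Rintegral (mu : nat -> probability seqspace R) k f n :
  invariant_sequence S phi mu -> dr_lipschitz r (Sigma S k) f ->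
  \int[mu k]_(x in Sigma S k) f x =
  \int[mu (k + n)%N]_(x in Sigma S (k + n)) ruelle_iter S phi k n f x.
Proof.
move=> [_ mu_dual] flip; elim: n => [|n ->]; first by rewrite addn0.
have nlip := ruelle_iter_lipschitz ruelle1 r01 phi_holder beta01 n flip.
rewrite addnS mu_dual//; first exact: dr_lipschitz_measurable nlip.
exact: dr_lipschitz_bounded.
Qed.

Hypothesis t_lt1 :
  (ereal_sup [set (tconst S phi r beta m u nn k)%:E | k in setT] < 1)%E.

Lemma tconst_bound : exists2 t, 0 <= t < 1 &
  forall k, tconst S phi r beta m u nn k <= t.
Proof.
have tle k : ((tconst S phi r beta m u nn k)%:E <=
    ereal_sup [set (tconst S phi r beta m u nn k)%:E | k in setT])%E.
  by apply: ereal_sup_ubound; exists k.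
(* The supremum is real: [t_lt1] excludes [+oo], and the member at 0 excludes [-oo]. *)
case: ereal_sup t_lt1 tle => [t t1 tle|//|_ /(_ 0%N)//].
exists t => [|k]; last by rewrite -lee_fin.
rewrite -lte_fin t1 andbT; have := tle 0%N; rewrite lee_fin; apply: le_trans.
by rewrite le_max; case/andP: beta01 => /ltW ->.
Qed.

(** An interval of length [eps] holding all values of the iterate also holds its mean, which by
    invariance is the integral of [f]. *)
Lemma ruelle_iter_cvg (mu : nat -> probability seqspace R) k f :
  invariant_sequence S phi mu -> dr_lipschitz r (Sigma S k) f ->
  forall eps, 0 < eps -> exists N, forall n, (N <= n)%N ->
    forall x, Sigma S (k + n) x ->
    `|ruelle_iter S phi k n f x - \int[mu k]_(y in Sigma S k) f y| <= eps.
Proof.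
move=> hmu flip eps eps0; have [t t01 tt] := tconst_bound.
have [N hN] := osc_decay ruelle1 r01 phi_holder beta01 m_gt0 hU hu hnn t01 tt flip eps0.
exists N => n /hN[c cf] x kx; rewrite (invariant_Rintegral n hmu flip).
have nlip := ruelle_iter_lipschitz ruelle1 r01 phi_holder beta01 n flip.
have := Rintegral_itv (Sigma_measurable S (k + n)) (hmu.1 (k + n)%N)
  (dr_lipschitz_measurable r01 nlip) cf.
by have := cf x kx; rewrite ler_distl => /andP[? ?] /andP[? ?]; apply/andP; split; lra.
Qed.

Lemma Sigma_neq0 (mu : nat -> probability seqspace R) k :
  invariant_sequence S phi mu -> Sigma S k !=set0.
Proof.
move=> [mu1 _]; apply/set0P/eqP => k0.
by have := mu1 k; rewrite k0 measure0 => -[] /esym/eqP; rewrite oner_eq0.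
Qed.

Lemma dr_lipschitz_wordset k w : dr_lipschitz r (Sigma S k) (\1_(wordset w) : _ -> R).
Proof.
have [r0 r1] := andP r01.
(* The indicator changes only between points that differ before index [size w], hence lie at
   distance at least [r ^+ size w]. *)
exists (r ^- size w) => x y _ _; have [d0 _] := andP (seqdist_itv r01 x y).
have [xw|xw] := pselect (agree (size w) x y).
  rewrite !indicE (_ : (y \in wordset w) = (x \in wordset w)).
    by rewrite subrr normr0 mulr_ge0// invr_ge0 exprn_ge0// ltW.
  by apply/idP/idP => /set_mem wx; apply/mem_set => i iw; rewrite -wx ?xw.
apply: (@le_trans _ _ 1).
  by rewrite !indicE; do 2 case: (_ \in _) => /=;
    rewrite ?(subrr, subr0, sub0r, normrN, normr0, normr1, ler01).
rewrite mulrC ler_pdivlMr ?exprn_gt0// mul1r.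
case: seqdistP => [xy|n xyn ltn]; first by case: xw; rewrite xy.
rewrite ler_wiXn2l ?ltW// leqNgt; apply/negP => wn; case: xw => i iw.
by rewrite ltn// (leq_trans iw)// ltnW.
Qed.

(** Both integrals of the indicator of a cylinder are approximated by one number, the value of a
    late iterate at a single point. *)
Lemma invariant_sequence_unique (mu nu : nat -> probability seqspace R) :
  invariant_sequence S phi mu -> invariant_sequence S phi nu ->
  forall k (B : set seqspace), measurable B -> nu k B = mu k B.
Proof.
move=> hmu hnu k; apply: probability_unique_wordset => w.
have flip := dr_lipschitz_wordset k w.
have wE (P : nat -> probability seqspace R) : invariant_sequence S phi P ->
    P k (wordset w) = (\int[P k]_(y in Sigma S k) \1_(wordset w) y)%:E.
  move=> [P1 _]; have [mS mw] := (Sigma_measurable S k, measurable_wordset w).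
  rewrite /Rintegral integral_indic//.
  rewrite fineK ?fin_num_measure//; last exact: measurableI.
  exact/esym/probability_setI1.
rewrite !wE//; congr (_%:E).
apply/eqP; rewrite -subr_eq0 -normr_le0; apply/ler_addgt0Pl => eps eps0.
rewrite addr0; have e2 : 0 < eps / 2 by rewrite divr_gt0.
have [N1 hN1] := ruelle_iter_cvg hmu flip e2.
have [N2 hN2] := ruelle_iter_cvg hnu flip e2.
pose n := maxn N1 N2; have [x kx] := Sigma_neq0 (k + n) hmu.
have := hN1 n (leq_maxl _ _) x kx; have := hN2 n (leq_maxr _ _) x kx.
by rewrite !ler_distl; lra.
Qed.

Lemma ruelle_iter_ecvg (mu : nat -> probability seqspace R) k f :
  invariant_sequence S phi mu -> dr_lipschitz r (Sigma S k) f ->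
  (fun n => ereal_sup
     [set `|ruelle_iter S phi k n f x - \int[mu k]_(y in Sigma S k) f y|%:E
       | x in Sigma S (k + n)]) @ \oo --> (0 : \bar R).
Proof.
move=> hmu flip; set s := (fun n => ereal_sup _).
have s_small eps : 0 < eps -> exists N, forall n, (N <= n)%N ->
    (0 <= s n <= eps%:E)%E.
  move=> eps0; have [N hN] := ruelle_iter_cvg hmu flip eps0.
  exists N => n Nn; apply/andP; split; last first.
    by apply: ge_ereal_sup => _ [x kx <-]; rewrite lee_fin hN.
  (* The supremum of an empty set would be [-oo]; a point of [Sigma S (k + n)] makes it
     nonnegative. *)
  have [x kx] := Sigma_neq0 (k + n) hmu.
  apply: (@le_trans _ _ (`|ruelle_iter S phi k n f x -
    \int[mu k]_(y in Sigma S k) f y|%:E)); first by rewrite lee_fin.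
  by apply: ereal_sup_ubound; exists x.
apply/fine_cvgP; split.
  have [N hN] := s_small _ ltr01; exists N => // n /hN/andP[s0 s1].
  by rewrite fin_numE; case: (s n) s0 s1.
apply/cvgrPdist_le => eps /s_small[N hN]; exists N => // n /hN; rewrite /comp.
case: (s n) => [a||] /andP[]; rewrite ?lee_fin// => a0 ae.
by rewrite /= sub0r normrN ger0_norm.
Qed.

End invariant_sequences.

Theorem corollary2p1 (R : realType) (S : shift_data)
    (phi : nat -> seqspace -> R) (I K : set nat) (r beta : R)
    (o m nn : nat -> nat) (U : nat -> set (seq nat))
    (u : nat -> seqspace -> seq nat)
    (mu : nat -> probability seqspace R)
    (hS : nonstationary_shift R S)
    (hH : property_Hstar S phi I K r)
    (hmu : invariant_sequence S phi mu)
    (hbeta : 0 < beta < 1)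
    (ho : forall k, alph S k (o k))
    (hm : is_return_time R S I K o m)
    (hU : is_word_family S I o m U)
    (hu : is_word_choice S I o m U u)
    (hnn : forall k, (1 <= nn k)%N /\
       Num.floor (- ln (alphaconst S phi r beta k) / ln r) + 1 <= (nn k)%:Z)
    (ht : (ereal_sup [set (tconst S phi r beta m u nn k)%:E | k in setT] < 1)%E) :
  (forall nu : nat -> probability seqspace R, invariant_sequence S phi nu ->
     forall k (B : set seqspace), measurable B -> nu k B = mu k B) /\
  (forall k (f : seqspace -> R), dr_lipschitz r (Sigma S k) f ->
     (fun n => ereal_sup
        [set `|ruelle_iter S phi k n f x - \int[mu k]_(y in Sigma S k) f y|%:E
          | x in Sigma S (k + n)]) @ \oo --> (0 : \bar R)).
Proof.
have [_ ruelle1 r01 holder2 holder1] := hH.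
(* At levels in [K] the bound from index 1 onwards includes the one from index 2 onwards, with the
   same [kappa]. *)
have phi_holder n : locally_holder S r n 2 (phi n).
  have [/holder1[kappa [kappa0 hk]]|/holder2//] := pselect (K n).
  by exists kappa; split=> // j /ltnW; exact: hk.
have m_gt0 k : (0 < m k)%N by have [[]] := hm k.
have hnn' k := (hnn k).2.
split=> [nu hnu|k f flip].
  exact: (invariant_sequence_unique ruelle1 r01 phi_holder hbeta m_gt0 hU hu hnn' ht).
exact: (ruelle_iter_ecvg ruelle1 r01 phi_holder hbeta m_gt0 hU hu hnn' ht).
Qed.
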